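(* Let $n\ge 3$ and ${\boldsymbol y}\in\{0,1\}^{n-2}$ with run length profile $(r_1,\dots,r_R)$ and alternating-segment length profile $(a_1,\dots,a_A)$. Then $$\mathsf{H}^{\mathsf{In}}_{2\text{-}\mathsf{Del}}({\boldsymbol y})=\log_2\big(2n(n-1)\big)-\frac{W({\boldsymbol y})}{2n(n-1)},$$ where $W({\boldsymbol y})=\sum_{{\boldsymbol x}\in\{0,1\}^n}\omega_{{\boldsymbol y}}({\boldsymbol x})\log_2\omega_{{\boldsymbol y}}({\boldsymbol x})$ (terms with $\omega_{{\boldsymbol y}}({\boldsymbol x})=0$ omitted) equals $$\sum_{i=1}^{R}\mathcal F\!\left(\binom{r_i+2}{2}\right)+\sum_{1\le i<j\le R}\mathcal F\big((r_i+1)(r_j+1)\big)+\sum_{i=1}^{R}(n+1-R-r_i)\,\mathcal F(r_i+1)$$ $$+\sum_{i=1}^{A}\mathcal F\!\left(1+\sum_{j=b_i}^{f_i}a_j-(a_{b_i}-1)\mathbb I_{b_i\ne i}-(a_{f_i}-1)\mathbb I_{f_i\ne i}\right),$$ with $\mathcal F(a)=a\log_2 a$.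
   Context: For binary sequences ${\boldsymbol x}$ of length $N$ and ${\boldsymbol y}$ of length $\ell\le N$, $\omega_{{\boldsymbol y}}({\boldsymbol x})$ is the number of index tuples $1\le i_1<\dots<i_\ell\le N$ with $x_{i_j}=y_j$. The $k$-deletion channel with input length $n$ maps ${\boldsymbol x}\in\{0,1\}^n$ to ${\boldsymbol y}\in\{0,1\}^{n-k}$ with probability $\omega_{{\boldsymbol y}}({\boldsymbol x})/\binom nk$; under uniform transmission ($X$ uniform on $\{0,1\}^n$), $\mathsf{H}^{\mathsf{In}}_{k\text{-}\mathsf{Del}}({\boldsymbol y})=H(X\mid Y={\boldsymbol y})$ in bits, with posterior $P({\boldsymbol x}\mid {\boldsymbol y})=\Pr\{{\boldsymbol y}\mid{\boldsymbol x}\}/\sum_{{\boldsymbol x}'}\Pr\{{\boldsymbol y}\mid{\boldsymbol x}'\}$. A run is a maximal block of identical consecutive symbols; $(r_1,\dots,r_R)$ are the run lengths from left to right. An alternating segment of ${\boldsymbol y}$ is a contiguous substring in which any two consecutive symbols differ; it is maximal if it cannot be extended to the left or right within ${\boldsymbol y}$. $(a_1,\dots,a_A)$ are the lengths of the maximal alternating segments of ${\boldsymbol y}$ from left to right ($A$ is their number). For $i\in[1,A-1]$, $f_i$ is the smallest $j\in[i+1,A]$ with $a_j>1$, or $A$ if no such $j$ exists; $f_A=A$. For $i\in[2,A]$, $b_i$ is the largest $j\in[1,i-1]$ with $a_j>1$, or $1$ if no such $j$ exists; $b_1=1$. $\mathbb I$ is the indicator function. *)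

(* Defs.v *)
From mathcomp Require Import all_boot all_order all_algebra.
From mathcomp Require Import reals exp.
Set Implicit Arguments. Unset Strict Implicit. Unset Printing Implicit Defensive.
Import Order.TTheory GRing.Theory Num.Theory.
Local Open Scope ring_scope.

Definition omega (N l : nat) (y : l.-tuple bool) (x : N.-tuple bool) : nat :=
  #|[pred f : {ffun 'I_l -> 'I_N} |
      [forall i : 'I_l, forall j : 'I_l, (i < j)%N ==> (f i < f j)%N] &&
      [forall j : 'I_l, tnth x (f j) == tnth y j]]|.

Section Reals.
Variable R : realType.

Definition log2 (t : R) : R := ln t / ln 2.

Definition Fl (a : R) : R := a * log2 a.

Definition delPr (n k : nat) (y : (n - k).-tuple bool) (x : n.-tuple bool) : R :=
  (omega y x)%:R / ('C(n, k))%:R.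

(* posterior P(x | y) under uniform input *)
Definition posterior (n k : nat) (y : (n - k).-tuple bool) (x : n.-tuple bool) : R :=
  delPr y x / \sum_(x' : n.-tuple bool) delPr y x'.

Definition Hin (n k : nat) (y : (n - k).-tuple bool) : R :=
  - \sum_(x : n.-tuple bool | posterior y x != 0) posterior y x * log2 (posterior y x).

Definition Wsum (n k : nat) (y : (n - k).-tuple bool) : R :=
  \sum_(x : n.-tuple bool | omega y x != 0%N) Fl (omega y x)%:R.
End Reals.

Fixpoint runs_aux (b : bool) (c : nat) (s : seq bool) : seq nat :=
  match s with
  | [::] => [:: c]
  | x :: t => if x == b then runs_aux b c.+1 t else c :: runs_aux x 1 t
  end.
Definition runs (s : seq bool) : seq nat :=
  if s is x :: t then runs_aux x 1 t else [::].

Fixpoint alts_aux (b : bool) (c : nat) (s : seq bool) : seq nat :=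
  match s with
  | [::] => [:: c]
  | x :: t => if x == b then c :: alts_aux x 1 t else alts_aux x c.+1 t
  end.
Definition alts (s : seq bool) : seq nat :=
  if s is x :: t then alts_aux x 1 t else [::].

Definition at1 (a : seq nat) (j : nat) : nat := nth 0%N a j.-1.

Definition fidx (a : seq nat) (i : nat) : nat :=
  head (size a) [seq j <- iota i.+1 (size a - i) | (1 < at1 a j)%N].

Definition bidx (a : seq nat) (i : nat) : nat :=
  last 1%N [seq j <- iota 1 i.-1 | (1 < at1 a j)%N].

(* Main.v *)
(** Classify the [x] of length [n] by the length [s] of the block of letters
    equal to the first letter of [y = c^r u] with which [x] begins.  Once [x]
    leaves [y], an excess in length of at most 2 forces almost everything, so
    that the sum of [G (occ y x)] over all [x] satisfies a recursion on the run
    lengths, for an arbitrary [G] with [G 0 = G 1 = 0].  The only nonlocal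
    term comes from prolonging an alternating prefix by two letters; the
    number of occurrences of [y] there is 1 plus the total length of the runs
    that the alternating segment meets, and that is the argument of the last
    sum of the theorem, [1 + a_i + (i - b_i) + (f_i - i)].  The entropy formula
    follows since the total number of occurrences is [4 * 'C(n, 2)]. *)

Require Import Defs.
From mathcomp Require Import all_boot all_order all_algebra.
From mathcomp Require Import reals exp.
From mathcomp Require Import ring zify.
Set Implicit Arguments. Unset Strict Implicit. Unset Printing Implicit Defensive.
Import Order.TTheory GRing.Theory Num.Theory.
Local Open Scope ring_scope.

(** * Occurrences of a word in a slightly longer word *)

Fixpoint occ (y x : seq bool) {struct x} : nat :=
  match y, x with
  | [::], _ => 1
  | _ :: _, [::] => 0
  | b :: y', c :: x' => occ y x' + (c == b) * occ y' x'
  end%N.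

Section Occurrences.
Local Open Scope nat_scope.
Implicit Types (b c : bool) (x y z u : seq bool).

Lemma occ_nil x : occ [::] x = 1. Proof. by case: x. Qed.

Lemma occ_cons b y c x :
  occ (b :: y) (c :: x) = occ (b :: y) x + (c == b) * occ y x.
Proof. by []. Qed.

Lemma occ_same c y x : occ (c :: y) (c :: x) = occ y x + occ (c :: y) x.
Proof. by rewrite occ_cons eqxx mul1n addnC. Qed.

Lemma occ_skip c y x : ohead y != Some c -> occ y (c :: x) = occ y x.
Proof.
case: y => [|b y]; first by rewrite !occ_nil.
by move=> /= neq_bc; rewrite [c == b]eq_sym (negPf (neq_bc : b != c)) addn0.
Qed.

Lemma occ_small y x : size x < size y -> occ y x = 0.
Proof.
elim: x y => [|c x IHx] [|b y] //= lt_xy.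
by rewrite !IHx ?muln0 // ltnW.
Qed.

Lemma occ_eq_size y x : size x = size y -> occ y x = (x == y).
Proof.
elim: x y => [|c x IHx] [|b y] //= [eq_xy].
by rewrite occ_small ?eq_xy //= IHx // eqseq_cons mulnb.
Qed.

#[global] Arguments occ : simpl never.

Lemma nseq_catr c s x : nseq s c ++ c :: x = nseq s.+1 c ++ x.
Proof. by elim: s => //= s ->. Qed.

Lemma eq_nseq_cat c s x y : (nseq s c ++ x == nseq s c ++ y) = (x == y).
Proof. by elim: s => //= s IHs; rewrite eqseq_cons eqxx. Qed.

Lemma neq_negb_cons c x y : (~~ c :: x == c :: y) = false.
Proof. by rewrite eqseq_cons; case: c. Qed.

(** Splits on whether the first [c] of the longer word is matched. The first term keeps the
    difference of lengths with one [c] less, the second lowers that difference by one, so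
    differences of 1 and 2 come down to equality tests. *)
Lemma occ_nseqS c s u z :
  occ (nseq s.+1 c ++ u) (nseq s.+1 c ++ z) =
  occ (nseq s c ++ u) (nseq s c ++ z) + occ (nseq s c ++ c :: u) (nseq s c ++ z).
Proof. by rewrite nseq_catr /= occ_same addnC. Qed.

Lemma occ_nseq1_neg c s u z : size z = size u ->
  occ (nseq s c ++ u) (nseq s c ++ ~~ c :: z) = occ u (~~ c :: z).
Proof.
move=> sz_z; elim: s => // s IHs; rewrite occ_nseqS {}IHs.
rewrite [X in (_ + X)%N]occ_eq_size; last first.
  by rewrite !size_cat /= sz_z.
by rewrite eq_nseq_cat neq_negb_cons addn0.
Qed.

Lemma occ_nseq1_pos c s u z : size z = size u -> ohead u != Some c ->
  occ (nseq s c ++ u) (nseq s c ++ c :: z) = s.+1 * (z == u).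
Proof.
move=> sz_z u_c; elim: s => [|s IHs].
  by rewrite /= occ_skip // occ_eq_size // mul1n.
rewrite occ_nseqS {}IHs.
rewrite [X in (_ + X)%N]occ_eq_size; last by rewrite !size_cat /= sz_z.
by rewrite eq_nseq_cat eqseq_cons eqxx addnC -mulSn.
Qed.

(** Each of the [s] splittings leaves [c :: u] inside a word that starts with [~~ c] and has one
    letter too many. That [~~ c] is the letter to skip, hence [s] copies of the test
    [z == c :: u]. *)
Lemma occ_nseq2_neg c s u z : size z = (size u).+1 ->
  occ (nseq s c ++ u) (nseq s c ++ ~~ c :: z) =
  occ u (~~ c :: z) + s * (z == c :: u).
Proof.
move=> sz_z; elim: s => [|s IHs]; first by rewrite mul0n addn0.
rewrite occ_nseqS {}IHs occ_nseq1_neg //.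
rewrite [occ (c :: u) _]occ_skip; last by case: (c).
by rewrite [occ (c :: u) _]occ_eq_size // -addnA [X in _ + X]addnC -mulSn.
Qed.

Lemma occ_nseq2_pos_neg c s u z : size z = size u -> ohead u != Some c ->
  occ (nseq s c ++ u) (nseq s c ++ c :: ~~ c :: z) =
  s.+1 * occ u (~~ c :: z).
Proof.
move=> sz_z u_c; elim: s => [|s IHs]; first by rewrite /= occ_skip // mul1n.
rewrite occ_nseqS {}IHs !nseq_catr occ_nseq1_neg //.
by rewrite addnC -mulSn.
Qed.

Lemma occ_nseq2_pos_pos c s u z : size z = size u -> ohead u != Some c ->
  occ (nseq s c ++ u) (nseq s c ++ c :: c :: z) = 'C(s.+2, 2) * (z == u).
Proof.
move=> sz_z u_c; elim: s => [|s IHs].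
  by rewrite /= !occ_skip // occ_eq_size // mul1n.
rewrite occ_nseqS {}IHs.
rewrite [X in _ + X](_ : _ = s.+2 * (z == u)).
  by rewrite [in RHS]binS bin1 mulnDl.
rewrite !(nseq_catr c s).
exact: occ_nseq1_pos.
Qed.

End Occurrences.

(** * Occurrences as increasing index maps *)

Section Embeddings.
Local Open Scope nat_scope.
Implicit Types x y : seq bool.

(** The predicate of [omega] on plain lists, so that first letters can be peeled off; the default
    [false] is never read when the lengths are [l] and [N]. *)
Definition embedding l N y x : pred {ffun 'I_l -> 'I_N} :=
  [pred f : {ffun 'I_l -> 'I_N} |
     [forall i : 'I_l, forall j : 'I_l, (i < j) ==> (f i < f j)] &&
     [forall j : 'I_l, nth false x (f j) == nth false y j]].

Lemma embeddingP l N y x (f : {ffun 'I_l -> 'I_N}) :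
  reflect ({homo f : i j / i < j} /\
           forall j, nth false x (f j) = nth false y j)
          (f \in @embedding l N y x).
Proof.
apply: (iffP andP) => [[/forallP f_incr /forallP f_letter] | [f_incr f_letter]].
  split=> [i j lt_ij | j]; last exact/eqP.
  by have /forallP/(_ j)/implyP := f_incr i; apply.
split; last by apply/forallP => j; apply/eqP.
by apply/forallP => i; apply/forallP => j; apply/implyP/f_incr.
Qed.

Definition skip_first l N (g : {ffun 'I_l -> 'I_N}) : {ffun 'I_l -> 'I_N.+1} :=
  [ffun i => lift ord0 (g i)].

Definition use_first l N (g : {ffun 'I_l -> 'I_N}) :
    {ffun 'I_l.+1 -> 'I_N.+1} :=
  [ffun i => if unlift ord0 i is Some j then lift ord0 (g j) else ord0].

Lemma skip_first_inj l N : injective (@skip_first l N).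
Proof.
move=> g h /ffunP eq_gh; apply/ffunP => i; have := eq_gh i.
by rewrite !ffunE => /lift_inj.
Qed.

Lemma use_first_inj l N : injective (@use_first l N).
Proof.
move=> g h /ffunP eq_gh; apply/ffunP => i; have := eq_gh (lift ord0 i).
by rewrite !ffunE liftK => /lift_inj.
Qed.

(** An increasing map either avoids position 0, and is then a [skip_first], or sends index 0 there,
    and is then a [use_first]. These are the two summands of [occ_cons]. *)
Lemma card_embedding x y l N : size x = N -> size y = l ->
  #|@embedding l N y x| = occ y x.
Proof.
move=> <- <- {l N}; elim: x y => [|c x IHx] [|b y].
- rewrite (eq_card (B := predT)); first by rewrite card_ffun !card_ord expn0.
  by move=> f; rewrite !inE; apply/embeddingP; split=> [] [].
- rewrite eq_card0 // => f; by case: (f ord0).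
- rewrite (eq_card (B := predT)); first by rewrite card_ffun !card_ord expn0.
  by move=> f; rewrite !inE; apply/embeddingP; split=> [] [].
rewrite occ_cons -!IHx.
rewrite -(cardID [pred f : {ffun _ -> _} | f ord0 != ord0]); congr (_ + _).
  rewrite -[RHS](card_image (@skip_first_inj _ _)); apply: eq_card => f.
  apply/andP/imageP => [[] | [g /embeddingP[g_incr g_letter] ->]]; last first.
    split; last by rewrite !inE ffunE.
    apply/embeddingP; split=> [i j lt_ij | j]; rewrite !ffunE !lift0 ?ltnS.
      exact: g_incr.
    exact: g_letter.
  rewrite !inE => /embeddingP[f_incr f_letter] f0_gt0.
  have f_gt0 i : 0 < f i.
    case: (unliftP ord0 i) => [j|] ->; last by rewrite lt0n.
    by apply: leq_ltn_trans (f_incr ord0 _ _).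
  have f_lt i : (f i).-1 < size x.
    by have := ltn_ord (f i); rewrite -{1}(prednK (f_gt0 i)).
  exists [ffun i => Ordinal (f_lt i)].
    apply/embeddingP; split=> [i j lt_ij | j]; rewrite !ffunE /=.
      by rewrite -ltnS !prednK // f_incr.
    by rewrite -f_letter -{2}(prednK (f_gt0 j)).
  by apply/ffunP => i; apply/val_inj; rewrite !ffunE /= /bump /= add1n prednK.
case: eqVneq => [<-|neq_cb]; last first.
  rewrite mul0n eq_card0 // => f; apply/negP => /andP[/negbNE/eqP f0].
  case/embeddingP => _ /(_ ord0); rewrite f0 /= => eq_cb.
  by rewrite eq_cb eqxx in neq_cb.
rewrite mul1n -[RHS](card_image (@use_first_inj _ _)); apply: eq_card => f.
apply/andP/imageP => [[] | [g /embeddingP[g_incr g_letter] ->]]; last first.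
  split; first by rewrite !inE ffunE unlift_none.
  apply/embeddingP; split=> [i j | j]; rewrite !ffunE.
    case: (unliftP ord0 i) => [i'|] ->; case: (unliftP ord0 j) => [j'|] -> //.
    by rewrite !lift0 !ltnS; apply: g_incr.
  by case: (unliftP ord0 j) => [j'|] ->; rewrite ?lift0 //= g_letter.
move=> /negbNE/eqP f0 /embeddingP[f_incr f_letter].
have f_gt0 i : 0 < f (lift ord0 i).
  by apply: leq_ltn_trans (f_incr ord0 _ _).
have f_lt i : (f (lift ord0 i)).-1 < size x.
  by have := ltn_ord (f (lift ord0 i)); rewrite -{1}(prednK (f_gt0 i)).
exists [ffun i => Ordinal (f_lt i)].
  apply/embeddingP; split=> [i j lt_ij | j]; rewrite !ffunE /=.
    by rewrite -ltnS !prednK // f_incr // !lift0 ltnS.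
  by have := f_letter (lift ord0 j); rewrite -{1}(prednK (f_gt0 j)) lift0.
apply/ffunP => i; apply/val_inj; rewrite ffunE.
case: (unliftP ord0 i) => [j|] -> /=; last by rewrite f0.
by rewrite ffunE /= /bump add1n prednK.
Qed.

Lemma omegaE N l (y : l.-tuple bool) (x : N.-tuple bool) : omega y x = occ y x.
Proof.
rewrite -(card_embedding (size_tuple x) (size_tuple y)).
apply: eq_card => f; rewrite !inE; congr (_ && _); apply: eq_forallb => j.
by rewrite !(tnth_nth false).
Qed.

End Embeddings.

(** * Sums over binary words, split along the first run *)

Section Sums.
Variable R : comNzRingType.
Implicit Types (H : seq bool -> R) (G : nat -> R) (c : bool) (u w z : seq bool).

Fixpoint bsum n H : R :=
  if n is n'.+1 then bsum n' (H \o cons true) + bsum n' (H \o cons false)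
  else H [::].

Lemma bsumE n H : \sum_(x : n.-tuple bool) H x = bsum n H.
Proof.
elim: n H => [|n IHn] H /=.
  by rewrite (big_pred1 [tuple]) // => x; rewrite [x]tuple0; apply/esym/eqP.
rewrite -!IHn.
rewrite (reindex (fun p : bool * n.-tuple bool => [tuple of p.1 :: p.2])) /=.
  by rewrite -(pair_bigA _ (fun b (x : n.-tuple bool) => H (b :: x))) big_bool.
exists (fun x => (thead x, [tuple of behead x])) => [[b x] _ | x _] /=.
  by congr (_, _); apply/val_inj.
by case/tupleP: x => b x; apply/val_inj.
Qed.

Lemma eq_bsum n H H' :
  (forall z, size z = n -> H z = H' z) -> bsum n H = bsum n H'.
Proof.
elim: n H H' => [|n IHn] H H' eqH /=; first exact: eqH.
by congr (_ + _); apply: IHn => z sz_z; apply: eqH; rewrite /= sz_z.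
Qed.

Lemma bsumS c n H :
  bsum n.+1 H = bsum n (H \o cons c) + bsum n (H \o cons (~~ c)).
Proof. by case: c => //=; rewrite addrC. Qed.

Lemma bsumD n H H' : bsum n (fun z => H z + H' z) = bsum n H + bsum n H'.
Proof.
elim: n H H' => //= n IHn H H'.
by rewrite -!/(bsum _ _) (IHn (H \o cons true)) (IHn (H \o cons false)) addrACA.
Qed.

Lemma bsum0 n : bsum n (fun=> 0) = 0.
Proof. by elim: n => //= n IHn; rewrite /comp IHn addr0. Qed.

Lemma bsum_delta w (t : R) : bsum (size w) (fun z => t *+ (z == w)) = t.
Proof.
elim: w => //= c w IHw; rewrite -/(bsum (size w).+1 _) (bsumS c).
rewrite [X in X + _](_ : _ = t); last first.
  by rewrite -[RHS]IHw; apply: eq_bsum => z _; rewrite /= eqseq_cons eqxx.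
rewrite [X in _ + X](_ : _ = 0) ?addr0// -[RHS](bsum0 (size w)).
by apply: eq_bsum => z _; rewrite /= neq_negb_cons.
Qed.

(** Serves the recursions in which a summand changes at a single exceptional word. *)
Lemma bsum_update w n H H' : size w = n ->
    (forall z, size z = n -> z != w -> H' z = H z) ->
  bsum n H' = bsum n H - H w + H' w.
Proof.
move=> <- eqH; rewrite -addrA -[X in _ + X](bsum_delta w) -bsumD.
apply: eq_bsum => z sz_z; case: eqVneq => [->|neq].
  by rewrite mulr1n addNKr.
by rewrite mulr0n addr0 eqH.
Qed.

(** With [Fl] for [G], [excess2] is the W of the theorem; [excess1] enters its recursion. *)
Definition excess1 G u := bsum (size u).+1 (fun z => G (occ u z)).
Definition excess2 G u := bsum (size u).+2 (fun z => G (occ u z)).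

(* The value of [occ] at the supersequence that prolongs the first alternating
   segment of [u] by two letters. *)
Definition alt_occ c u := occ u (~~ c :: c :: u).

Arguments bsum : simpl never.

Section FirstRun.
Variables (c : bool) (u : seq bool).
Hypothesis u_c : ohead u != Some c.

(** Complementary counting: a word that starts with [c] must skip it, so only [c :: u] contributes
    there, with [G 1]. *)
Lemma bsum_head1 G : G 0%N = 0 ->
  bsum (size u) (fun z => G (occ u (~~ c :: z))) = excess1 G u - G 1%N.
Proof.
move=> G0; rewrite /excess1 (bsumS c) [X in X + _ - _](_ : _ = G 1%N).
  by rewrite addrAC subrr add0r.
rewrite -[RHS](bsum_delta u); apply: eq_bsum => z sz_z /=.
by rewrite occ_skip // occ_eq_size //; case: eqP => _; rewrite ?G0.
Qed.

Lemma bsum_head2 G :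
  bsum (size u).+1 (fun z => G (occ u (~~ c :: z))) = excess2 G u - excess1 G u.
Proof.
rewrite /excess2 [bsum _.+2 _](bsumS c) [X in X + _ - _](_ : _ = excess1 G u).
  by rewrite addrAC subrr add0r.
by apply: eq_bsum => z _; rewrite /= occ_skip.
Qed.

(** Here [s] letters of the run are read and [e] are to come; induction on [e] passes letters from
    one to the other, and later uses have [s = 0]. Leaving the run early uses up the excess and
    forces the rest, which gives [G 1] for each of [e] places. *)
Lemma excess1_nseq G s e : G 0%N = 0 ->
  bsum (size (nseq e c ++ u)).+1
    (fun z => G (occ (nseq (s + e) c ++ u) (nseq s c ++ z))) =
  G (s + e).+1 + excess1 G u - G 1%N + G 1%N *+ e.
Proof.
move=> G0; elim: e s => [|e IHe] s.
  rewrite addn0 mulr0n addr0 -addrA -bsum_head1 // [LHS](bsumS c); congr (_ + _).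
    rewrite -[RHS](bsum_delta u); apply: eq_bsum => z sz_z.
    by rewrite /= occ_nseq1_pos //; case: eqP => _; rewrite ?muln1 ?muln0.
  by apply: eq_bsum => z sz_z; rewrite /= occ_nseq1_neg.
rewrite [LHS](bsumS c) addnS -addSn mulrSr [RHS]addrA -IHe; congr (_ + _).
  by apply: eq_bsum => z sz_z /=; rewrite nseq_catr.
rewrite -[RHS](bsum_delta (nseq e.+1 c ++ u)).
apply: eq_bsum => z sz_z; rewrite /comp addSnnS nseqD -catA occ_nseq1_neg //.
rewrite occ_skip; last by case: (c).
by rewrite occ_eq_size //; case: eqP => _; rewrite ?G0.
Qed.

(** Each of the [e] early departures is worth [excess1 G u + G (s + e).+1], where [s + e] is
    invariant. A word that reads the whole run goes on with [c c], with [c] and [~~ c], or with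
    [~~ c]: the binomial term, the bracket with rescaled [G], and the last bracket. *)
Lemma excess2_nseq G s e : G 0%N = 0 -> G 1%N = 0 ->
  bsum (size (nseq e c ++ u)).+2
    (fun z => G (occ (nseq (s + e) c ++ u) (nseq s c ++ z))) =
  (excess1 G u + G (s + e).+1) *+ e + G 'C((s + e).+2, 2)
  + (excess1 (fun k => G ((s + e).+1 * k)%N) u - G (s + e).+1)
  + (excess2 G u - excess1 G u - G (alt_occ c u) + G (alt_occ c u + (s + e))%N).
Proof.
move=> G0 G1; elim: e s => [|e IHe] s.
  rewrite addn0 mulr0n add0r -bsum_head2 [LHS](bsumS c); congr (_ + _).
    rewrite [LHS](bsumS c); congr (_ + _).
      rewrite -[RHS](bsum_delta u); apply: eq_bsum => z sz_z.
      by rewrite /= occ_nseq2_pos_pos //; case: eqP => _; rewrite ?muln1 ?muln0.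
    rewrite -[X in _ - G X]muln1 -[RHS](@bsum_head1 (fun k => G (s.+1 * k)%N)).
      by apply: eq_bsum => z sz_z; rewrite /= occ_nseq2_pos_neg.
    by rewrite muln0.
  (* Only [z = c :: u] allows occurrences beyond those of [u]: there are [s] more, on top of
     [alt_occ c u]. *)
  rewrite (@bsum_update (c :: u) _ (fun z => G (occ u (~~ c :: z)))) //.
    by rewrite /= occ_nseq2_neg // eqxx muln1.
  by move=> z sz_z neq_z; rewrite /= occ_nseq2_neg // (negPf neq_z) muln0 addn0.
(* Early departure, with [w] still to be matched: an excess-one sum for [w], altered only at
   [c :: w], where [s] more occurrences turn [G e.+2] into [G (s + e.+1).+1]. *)
have B_neg : bsum (size (nseq e.+1 c ++ u)).+1
    ((fun z => G (occ (nseq (s + e.+1) c ++ u) (nseq s c ++ z))) \o cons (~~ c))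
  = excess1 G u + G (s + e.+1).+1.
  set w := nseq e.+1 c ++ u.
  have w_skip z : occ w (~~ c :: z) = occ w z by rewrite occ_skip //=; case: (c).
  have occ_w : occ w (c :: w) = e.+2.
    by rewrite -[c :: w](nseq_catr c e.+1 u) occ_nseq1_pos // eqxx muln1.
  have sz_w : size (c :: w) = (size w).+1 by [].
  rewrite (@bsum_update (c :: w) _ (fun z => G (occ w z)) _ sz_w)
    => [|z sz_z neq_z].
    rewrite [X in X - _ + _](excess1_nseq 0 e.+1 G0) occ_w /comp nseqD -catA -/w.
    rewrite occ_nseq2_neg // w_skip occ_w eqxx muln1 G1 mul0rn addr0 subr0.
    by rewrite add0n [_ + _ - _]addrC addKr (addnC e.+2) addnS.
  rewrite /comp nseqD -catA -/w occ_nseq2_neg // w_skip (negPf neq_z).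
  by rewrite muln0 addn0.
rewrite [LHS](bsumS c) {}B_neg addnS -addSn.
rewrite [X in X + _](_ : _ = bsum (size (nseq e c ++ u)).+2
    (fun z => G (occ (nseq (s.+1 + e) c ++ u) (nseq s.+1 c ++ z)))); last first.
  by apply: eq_bsum => z sz_z /=; rewrite nseq_catr.
by rewrite IHe mulrSr; ring.
Qed.

End FirstRun.
End Sums.

(** * Words described by their run lengths *)

Fixpoint of_runs c (rs : seq nat) : seq bool :=
  if rs is r :: rs' then nseq r c ++ of_runs (~~ c) rs' else [::].

(** The value of [alt_occ] on run lengths: the first alternating segment passes through the runs of
    length 1 and stops in the first longer run, which still counts in full. *)
Fixpoint first_alt_occ (rs : seq nat) : nat :=
  if rs is r :: rs' then
    if r == 1 then (first_alt_occ rs').+1 else r.+1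
  else 1%N.

Section RunLengths.
Implicit Types (c : bool) (rs : seq nat).

Lemma size_of_runs c rs : size (of_runs c rs) = sumn rs.
Proof. by elim: rs c => //= r rs IHrs c; rewrite size_cat size_nseq IHrs. Qed.

Lemma ohead_of_runs c rs : all (leq 1) rs ->
  ohead (of_runs (~~ c) rs) != Some c.
Proof. by case: rs => [|[|r] rs] //= _; case: c. Qed.

Lemma of_runs_aux c k s : of_runs c (runs_aux c k s) = nseq k c ++ s.
Proof.
elim: s c k => [|x s IHs] c k //=; case: eqVneq => [->|neq_xc].
  by rewrite IHs nseq_catr.
by rewrite /= (_ : ~~ c = x) ?IHs //; case: x c neq_xc => [] [].
Qed.

Lemma runs_aux_gt0 c k s : (0 < k)%N -> all (leq 1) (runs_aux c k s).
Proof.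
by elim: s c k => [|x s IHs] c k k_gt0 /=; [|case: eqP => _ /=];
  rewrite ?k_gt0 ?IHs.
Qed.

Lemma of_runsK s : of_runs (head true s) (runs s) = s.
Proof. by case: s => // c s; rewrite /= of_runs_aux. Qed.

Lemma runs_gt0 s : all (leq 1) (runs s).
Proof. by case: s => // c s; apply: runs_aux_gt0. Qed.

(** Skipping the leading [~~ c] leaves one occurrence. Matching it as a run of length 1 poses the
    same question for the other runs with the letters exchanged; in a longer run it leaves [r] equal
    letters of which one is to be omitted. *)
Lemma alt_occ_of_runs c rs : all (leq 1) rs ->
  alt_occ c (of_runs (~~ c) rs) = first_alt_occ rs.
Proof.
rewrite /alt_occ; elim: rs c => [|r rs IHrs] c; first by rewrite occ_nil.
move=> /andP[r_gt0 rs_gt0] /=; rewrite negbK.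
have v_c := ohead_of_runs (~~ c) rs_gt0; rewrite negbK in v_c.
move: (IHrs (~~ c) rs_gt0); rewrite negbK.
set v := of_runs c rs in v_c * => occ_v.
have skip_c w z : occ (~~ c :: w) (c :: z) = occ (~~ c :: w) z.
  by rewrite occ_skip //=; case: (c).
case: r r_gt0 => [//|[|k]] _.
  by rewrite /= occ_same occ_v skip_c occ_eq_size // eqxx addn1.
set w := nseq k.+1 (~~ c) ++ v.
have occ_w : occ w (~~ c :: w) = k.+2.
  by rewrite -[~~ c :: w](nseq_catr (~~ c) k.+1 v) occ_nseq1_pos // eqxx muln1.
rewrite -[nseq k.+2 _ ++ v]/(~~ c :: w) occ_same !skip_c occ_w.
by rewrite occ_eq_size // eqxx addn1.
Qed.

End RunLengths.

(** * Closed forms in the run lengths *)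

Section ClosedForms.
Variable R : comNzRingType.
Implicit Types (G : nat -> R) (c : bool) (rs : seq nat).

Fixpoint pair_sum G rs : R :=
  if rs is r :: rs' then
    \sum_(q <- rs') G (r.+1 * q.+1)%N + pair_sum G rs'
  else 0.

(* The contribution of the maximal alternating segments other than the first:
   such a segment either starts and ends inside one run of length [r], or
   starts with the last letter of a run of length [r >= 2]. *)
Fixpoint later_alt_sum G rs : R :=
  if rs is r :: rs' then
    (if r == 1%N then 0 else G r.+1 *+ (r - 2) + G (first_alt_occ rs' + r)%N)
    + later_alt_sum G rs'
  else 0.

Definition alt_sum G rs := G (first_alt_occ rs) + later_alt_sum G rs.

(** If [r = 1], the first segment is prolonged. Otherwise it is prolonged to start at the last
    letter of the new run, and the other [r - 1] letters of that run each give a new segment. *)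
Lemma alt_sum_cons G r rs : (0 < r)%N ->
  alt_sum G (r :: rs) =
  alt_sum G rs - G (first_alt_occ rs) + G (first_alt_occ rs + r)%N
  + G r.+1 *+ r.-1.
Proof.
rewrite /alt_sum; case: r => [//|[|k]] _ /=; first by rewrite addn1; ring.
by rewrite subSS subSS subn0 mulrS; ring.
Qed.

Lemma excess1_of_runs G c rs : G 0%N = 0 -> all (leq 1) rs ->
  excess1 G (of_runs c rs) =
  \sum_(r <- rs) G r.+1 + ((sumn rs)%:R + 2 - (size rs)%:R) * G 1%N.
Proof.
move=> G0; elim: rs c => [|r rs IHrs] c.
  by move=> _; rewrite big_nil /excess1 /bsum /= !occ_nil; ring.
move=> /andP[_ rs_gt0].
rewrite [LHS](excess1_nseq (ohead_of_runs c rs_gt0) 0 r G0).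
by rewrite IHrs // big_cons add0n /= natrD -natr1 -[_ *+ r]mulr_natl; ring.
Qed.

(** In [excess2_nseq], [excess1] of the rescaled [G] supplies the pairs with the first run and the
    coefficient of [G r.+1] in the third sum. The remaining [r - 1] copies of [G r.+1] are those of
    [alt_sum_cons]. *)
Lemma excess2_of_runs G c rs : G 0%N = 0 -> G 1%N = 0 -> all (leq 1) rs ->
  excess2 G (of_runs c rs) =
  \sum_(r <- rs) G 'C(r.+2, 2) + pair_sum G rs
  + \sum_(r <- rs) ((sumn rs)%:R + 3 - (size rs)%:R - r%:R) * G r.+1
  + alt_sum G rs.
Proof.
move=> G0 G1; elim: rs c => [|r rs IHrs] c.
  by move=> _; rewrite !big_nil /excess2 /bsum /alt_sum /= !occ_nil G1; ring.
move=> /andP[r_gt0 rs_gt0].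
rewrite [LHS](excess2_nseq (ohead_of_runs c rs_gt0) 0 r G0 G1).
(* The new run adds [r] to the length and 1 to the number of runs; the [r - 1] is matched by [r]
   copies of [excess1 G u] minus the subtracted one. *)
have coefE : \sum_(q <- rs)
      ((r + sumn rs)%:R + 3 - (size rs).+1%:R - q%:R) * G q.+1 =
    \sum_(q <- rs) ((sumn rs)%:R + 3 - (size rs)%:R - q%:R) * G q.+1
    + (r%:R - 1) * \sum_(q <- rs) G q.+1.
  rewrite big_distrr -big_split /=; apply: eq_bigr => q _.
  by rewrite natrD -natr1; ring.
have r1E : r.-1%:R = r%:R - 1 :> R by rewrite -subn1 natrB.
rewrite IHrs // alt_occ_of_runs // alt_sum_cons // !excess1_of_runs ?muln0 //.
rewrite !big_cons /= add0n G1 mulr0 addr0 muln1 {}coefE natrD -natr1.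
rewrite -(mulr_natl _ r) -(mulr_natl _ r.-1) r1E -[(size rs).+1%:R]natr1.
by ring.
Qed.

End ClosedForms.

(* This is [f_i - i] when [s] lists the lengths of the segments to the right
   of the [i]-th one. *)
Fixpoint right_reach (s : seq nat) : nat :=
  if s is x :: s' then (if 1 < x then 1 else (right_reach s').+1)%N else 0%N.

(* [L] is the distance [i - b_i] of the first segment of the list [s]. *)
Fixpoint seg_sum (R : comNzRingType) (G : nat -> R) (L : nat) (s : seq nat) : R :=
  if s is x :: s' then
    G (1 + x + L + right_reach s')%N
    + seg_sum G (if (1 < x)%N then 1 else L.+1)%N s'
  else 0.

(** * The alternating segments read along the runs *)

Section Segments.
Variables (R : comNzRingType) (G : nat -> R).

Lemma right_reach_alts_aux c q s : (1 < q)%N ->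
  right_reach (alts_aux c q s) = 1%N.
Proof.
elim: s c q => [|x s IHs] c q q_gt1 /=; first by rewrite q_gt1.
by case: eqP => _ /=; rewrite ?q_gt1 ?IHs // ltnW.
Qed.

Lemma runs_aux_head c k s r rs : runs_aux c k s = r :: rs -> (k <= r)%N.
Proof.
elim: s k => [|x s IHs] k /=; first by case=> ->.
by case: eqP => _; [move/IHs/ltnW | case=> ->].
Qed.

(** There are [r - k] one-letter segments before the one that starts at the last letter of the run;
    the latter is long or ends the list. *)
Lemma right_reach_alts_run c k s r rs : runs_aux c k s = r :: rs ->
  right_reach (alts_aux c 1 s) = (r - k).+1.
Proof.
elim: s k => [|x s IHs] k /=; first by case=> -> _; rewrite subnn.
case: eqP => [-> run_s | _ [-> _]].
  2: by rewrite right_reach_alts_aux // subnn.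
by rewrite /= (IHs _ run_s); have := runs_aux_head run_s; lia.
Qed.

(** Joint induction over two states: at the first letter of a run, with [q] letters in the current
    segment, and at the [k]-th letter of a run, where a segment starts. In the first state [q = 1]
    happens only at the start of the word, hence [L = 0]. *)
Lemma seg_sum_alts_aux c s :
  (forall q L, (0 < q)%N -> (q = 1%N -> L = 0%N) ->
     seg_sum G L (alts_aux c q s) =
     G (q + L + first_alt_occ (runs_aux c 1 s)).-1
     + later_alt_sum G (runs_aux c 1 s)) /\
  (forall k r rs, (1 < k)%N -> runs_aux c k s = r :: rs ->
     seg_sum G k.-1 (alts_aux c 1 s) =
     G r.+1 *+ (r - k) + G (first_alt_occ rs + r)%N + later_alt_sum G rs).
Proof.
elim: s c => [|x s IHs] c; split.
- move=> q L q_gt0 _ /=; rewrite !addr0 addn0; congr G; lia.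
- move=> [|k] r rs // _ [<- <-] /=; rewrite subnn mulr0n add0r.
  by congr (G _ + _); lia.
- move=> q L q_gt0 q1_L /=; case: eqVneq => [->|_] /=; last first.
    rewrite (proj1 (IHs x)) // => [|[] q0]; last by rewrite q0 in q_gt0.
    by rewrite add0r addnS; congr (G _ + _); lia.
  case run_s: (runs_aux c 2 s) => [|r rs].
    by have := of_runs_aux c 2 s; rewrite run_s.
  rewrite (right_reach_alts_run run_s).
  (* Either this segment is long, or it is the first one and [L = 0]. *)
  have -> : (if (1 < q)%N then 1 else L.+1)%N = 1%N.
    by case: ltnP => // q_le1; rewrite q1_L //; lia.
  have := runs_aux_head run_s.
  have [_ /(_ 2%N r rs isT run_s) -> r_gt1] := IHs c.
  have /negPf r_neq1 : r != 1%N by rewrite neq_ltn r_gt1 orbT.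
  rewrite /= r_neq1.
  by congr (G _ + _); lia.
- move=> [|k] r rs // _ /=; case: eqVneq => [->|_] /= run_s.
    have := runs_aux_head run_s => lt_kr.
    have [_ /(_ k.+2 r rs isT run_s) /= ->] := IHs c.
    rewrite (right_reach_alts_run run_s).
    rewrite (_ : r - k.+1 = (r - k.+2).+1)%N; last by lia.
    by rewrite mulrS -!addrA; congr (G _ + _); lia.
  case: run_s => <- <-; rewrite (proj1 (IHs x)) //.
  by rewrite subnn add0r; congr (G _ + _); lia.
Qed.

Lemma seg_sum_alts s : G 1%N = 0 -> seg_sum G 0 (alts s) = alt_sum G (runs s).
Proof.
(* The empty word has no segment, but [alt_sum] still contains [G 1]. *)
move=> G1; case: s => [|c s]; first by rewrite /alt_sum /= G1 addr0.
by rewrite /= (proj1 (seg_sum_alts_aux c s)) // addn0 addSn.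
Qed.

End Segments.

Lemma alts_aux_gt0 c k s : (0 < k)%N -> all (leq 1) (alts_aux c k s).
Proof.
by elim: s c k => [|x s IHs] c k k_gt0 /=; [|case: eqP => _ /=];
  rewrite ?k_gt0 ?IHs.
Qed.

Lemma alts_gt0 s : all (leq 1) (alts s).
Proof. by case: s => // c s; apply: alts_aux_gt0. Qed.

(** * The indices b_i and f_i *)

Section SegmentIndices.
Variables (R : comNzRingType) (a : seq nat).
Lemma bidxS i : (0 < i)%N ->
  bidx a i.+1 = if (1 < at1 a i)%N then i else bidx a i.
Proof.
case: i => // i _; rewrite /bidx -[i.+2.-1](addn1 i) iotaD.
rewrite filter_cat last_cat add1n /=.
by case: ifP.
Qed.

Lemma bidx_le i : (0 < i)%N -> (bidx a i <= i)%N.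
Proof.
case: i => // i _; elim: i => // i IHi.
by rewrite bidxS //; case: ifP => // _; apply: leqW.
Qed.

Lemma fidx_lt i : (i < size a)%N ->
  fidx a i = if (1 < at1 a i.+1)%N then i.+1 else fidx a i.+1.
Proof. by move=> lt_ia; rewrite /fidx -subnSK //=; case: ifP. Qed.

Lemma fidx_size : fidx a (size a) = size a.
Proof. by rewrite /fidx subnn. Qed.

(** The state carried by [seg_sum] is i - b_i, and [bidxS] is its update rule. *)
Lemma sum_segments (G : nat -> R) i : (0 < i)%N ->
  \sum_(i <= k < (size a).+1)
    G (1 + at1 a k + (k - bidx a k) + right_reach (drop k a))%N =
  seg_sum G (i - bidx a i) (drop i.-1 a).
Proof.
move Ek: ((size a).+1 - i)%N => k; elim: k i Ek => [|k IHk] i Ek i_gt0.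
  by rewrite big_geq ?drop_oversize //; lia.
have lt_ia : (i.-1 < size a)%N by lia.
rewrite big_ltn; last by lia.
rewrite (drop_nth 0%N lt_ia) prednK // /= -/(at1 a i); congr (_ + _).
rewrite IHk //; last by lia.
congr seg_sum; rewrite bidxS //; case: ifP => _; first by lia.
by rewrite subSn // bidx_le.
Qed.

Hypothesis a_gt0 : all (leq 1) a.

Lemma at1_le1 i : (0 < i <= size a)%N ->
  (1 < at1 a i)%N = false -> at1 a i = 1%N.
Proof.
case: i => // i /= lt_ia /negbT; rewrite -leqNgt => ai_le1.
by apply/eqP; rewrite eqn_leq ai_le1 (all_nthP 0%N a_gt0).
Qed.

(** Segments strictly between b_i and i have length 1, and the indicator term reduces the one at b_i
    to 1, so the sum counts indices. *)
Lemma left_sum i : (0 < i <= size a)%N ->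
  \sum_(bidx a i <= j < i) (at1 a j)%:R
  - ((at1 a (bidx a i))%:R - 1) * (bidx a i != i)%:R = (i - bidx a i)%:R :> R.
Proof.
case: i => // i; elim: i => [_|i IHi lt_ia].
  by rewrite big_geq // eqxx mulr0 subrr.
have bi_le := bidx_le (ltn0Sn i).
rewrite bidxS //; case: ifP => [_|ai_le1].
  by rewrite big_nat1 neq_ltn ltnSn mulr1 subSn // subnn; ring.
have ai : at1 a i.+1 = 1%N by apply: at1_le1 => //; apply: ltnW.
rewrite big_nat_recr //= ai subSn // -[_.+1%:R in RHS]natr1 -IHi.
2: exact: ltnW.
rewrite neq_ltn ltnS bi_le mulr1.
(* If b_i = i at the previous index, the indicator changes here, but its factor is 0 because that
   segment has length 1. *)
by case: eqP => [->|_]; rewrite ?ai /=; ring.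
Qed.

(** Mirror image of [left_sum]; the bound on [fidx] is carried along because it decides the
    indicator in the inductive step. *)
Lemma right_sum i : (i <= size a)%N ->
  (i <= fidx a i)%N /\
  \sum_(i.+1 <= j < (fidx a i).+1) (at1 a j)%:R
  - ((at1 a (fidx a i))%:R - 1) * (fidx a i != i)%:R
  = (right_reach (drop i a))%:R :> R.
Proof.
move Ek: (size a - i)%N => k; elim: k i Ek => [|k IHk] i Ek le_ia.
  have -> : i = size a by lia.
  by rewrite fidx_size drop_size big_geq // eqxx mulr0 subrr.
have lt_ia : (i < size a)%N by lia.
have [|//|le_fi IHi] := IHk i.+1; first by lia.
rewrite fidx_lt // (drop_nth 0%N) //= -/(at1 a i.+1).
case: ifP => [_|ai_le1].
  by rewrite leqnSn big_nat1 neq_ltn ltnSn orbT mulr1; split=> //; ring.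
have ai := @at1_le1 i.+1 lt_ia ai_le1.
split; first exact: ltnW.
rewrite big_ltn // ai -[_.+1%:R in RHS]natr1 -IHi neq_ltn le_fi orbT mulr1.
by case: eqP => [->|_]; rewrite ?ai /=; ring.
Qed.

Lemma segment_term i : (0 < i <= size a)%N ->
  1 + \sum_(bidx a i <= j < (fidx a i).+1) (at1 a j)%:R
    - ((at1 a (bidx a i))%:R - 1) * (bidx a i != i)%:R
    - ((at1 a (fidx a i))%:R - 1) * (fidx a i != i)%:R
  = (1 + at1 a i + (i - bidx a i) + right_reach (drop i a))%:R :> R.
Proof.
move=> /andP[i_gt0 le_ia]; have [le_if right_i] := right_sum le_ia.
rewrite (big_cat_nat (n := i)) ?bidx_le ?leqW //=.
rewrite [\sum_(i <= _ < _) _]big_ltn //.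
by rewrite !natrD -right_i -left_sum ?i_gt0 //; ring.
Qed.

End SegmentIndices.

(** * Total weight, entropy and the final formula *)

Section Entropy.
Variable R : realType.

(** Double counting: choose the positions of [y], then the other letters freely. The induction
    follows Pascal's rule. *)
Lemma sum_occ N (y : seq bool) :
  bsum N (fun x => (occ y x)%:R) = ('C(N, size y) * 2 ^ (N - size y))%:R :> R.
Proof.
elim: N y => [|N IHN] [|b y] //.
- rewrite (bsumS true) [X in X + _](_ : _ = bsum N (fun x => (occ [::] x)%:R)).
    rewrite [X in _ + X](_ : _ = bsum N (fun x => (occ [::] x)%:R)).
      by rewrite IHN /= !bin0 !mul1n !subn0 -natrD addnn -muln2 expnSr.
    by apply: eq_bsum => x _; rewrite /= !occ_nil.
  by apply: eq_bsum => x _; rewrite /= !occ_nil.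
rewrite (bsumS b) (@eq_bsum _ _ (_ \o cons b)
  (fun x => (occ y x)%:R + (occ (b :: y) x)%:R)) => [|x _]; last first.
  by rewrite /= occ_same natrD.
rewrite bsumD (@eq_bsum _ _ (_ \o cons (~~ b)) (fun x => (occ (b :: y) x)%:R)).
  rewrite !IHN -!natrD; congr _%:R; rewrite /= binS subSS.
  case: (ltnP (size y) N) => [lt_yN|le_Ny].
    by rewrite -[(N - size y)%N]subnSK // expnS; ring.
  (* The vanishing binomial hides the truncated exponent. *)
  by rewrite (@bin_small N (size y).+1) // !mul0n !addn0 add0n.
by move=> x _; rewrite /= occ_skip //=; case: b.
Qed.

Lemma sum_omega n (y : (n - 2).-tuple bool) : (2 <= n)%N ->
  \sum_(x : n.-tuple bool) (omega y x)%:R = (2 * n * (n - 1))%N%:R :> R.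
Proof.
move=> n_ge2; under eq_bigr do rewrite omegaE.
rewrite (bsumE _ (fun x => (occ y x)%:R)) sum_occ size_tuple subKn //.
rewrite bin_sub //.
congr _%:R; have := mul_bin_diag n 1; rewrite bin1 -subn1 => binE.
by rewrite -mulnA binE; lia.
Qed.

(** The channel's binomial cancels, so the posterior is [omega / S]; its logarithm splits, and the
    weights add up to [S]. *)
Lemma Hin_Wsum n k (y : (n - k).-tuple bool) (S : R) : (k <= n)%N -> 0 < S ->
    \sum_(x : n.-tuple bool) (omega y x)%:R = S ->
  Hin R y = log2 S - Wsum R y / S.
Proof.
move=> le_kn S_gt0 omega_S; have S_neq0 := lt0r_neq0 S_gt0.
have C_neq0 : 'C(n, k)%:R != 0 :> R by rewrite pnatr_eq0 -lt0n bin_gt0.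
have postE x : posterior R y x = (omega y x)%:R / S.
  by rewrite /posterior /delPr -mulr_suml omega_S; field; apply/andP.
have posterior_neq0 x : (posterior R y x != 0) = (omega y x != 0%N).
  by rewrite postE mulf_eq0 invr_eq0 (negPf S_neq0) orbF pnatr_eq0.
rewrite /Hin (eq_bigl _ _ posterior_neq0) /Wsum.
rewrite (eq_bigr (fun x => Fl (omega y x)%:R / S -
    (omega y x)%:R / S * log2 S)).
  have omega_neq0_S : \sum_(x : n.-tuple bool | omega y x != 0%N)
      (omega y x)%:R = S.
    rewrite -omega_S [RHS](bigID (fun x => omega y x != 0%N)) /=.
    by rewrite [X in _ + X]big1 ?addr0 // => x /negbNE/eqP ->.
  by rewrite sumrB -!mulr_suml omega_neq0_S divff //; ring.
move=> x omega_neq0; rewrite postE /Fl /log2 ln_div ?posrE ?ltr0n ?lt0n //.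
by ring.
Qed.

Lemma pair_sumE (G : nat -> R) r :
  \sum_(i < size r) \sum_(j < size r | (i < j)%N)
    G ((nth 0%N r i + 1) * (nth 0%N r j + 1))%N = pair_sum G r.
Proof.
elim: r => [|q r IHr] /=; first by rewrite big_ord0.
rewrite big_ord_recl /=; congr (_ + _).
  rewrite big_mkcond big_ord_recl /= add0r (big_nth 0%N) big_mkord.
  by apply: eq_bigr => i _; rewrite !addn1.
rewrite -IHr; apply: eq_bigr => i _.
by rewrite big_mkcond big_ord_recl /= add0r -big_mkcond.
Qed.

End Entropy.

Unset Implicit Arguments.

Theorem theorem3 (R : realType) (n : nat) (hn : (3 <= n)%N)
    (y : (n - 2).-tuple bool) :
  let r := runs y in
  let RR := size r in
  let a := alts y in
  let A := size a in
  Hin R y = log2 ((2 * n * (n - 1))%N%:R) - Wsum R y / ((2 * n * (n - 1))%N%:R)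
  /\
  Wsum R y =
    \sum_(i < RR) Fl ('C(nth 0%N r i + 2, 2))%:R
    + \sum_(i < RR) \sum_(j < RR | (i < j)%N)
        Fl ((nth 0%N r i + 1) * (nth 0%N r j + 1))%N%:R
    + \sum_(i < RR) (n%:R + 1 - RR%:R - (nth 0%N r i)%:R)
                     * Fl (nth 0%N r i + 1)%N%:R
    + \sum_(1 <= i < A.+1)
        Fl (1 + \sum_(bidx a i <= j < (fidx a i).+1) (at1 a j)%:R
              - ((at1 a (bidx a i))%:R - 1) * (bidx a i != i)%:R
              - ((at1 a (fidx a i))%:R - 1) * (fidx a i != i)%:R).
Proof.
move=> r RR a A; have n_ge2 := ltnW hn; split.
  apply: Hin_Wsum (sum_omega R y n_ge2) => //.
  by rewrite ltr0n !muln_gt0 subn_gt0 ltnW // ltnW.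
pose G k : R := Fl k%:R.
have G0 : G 0%N = 0 by rewrite /G /Fl mul0r.
have G1 : G 1%N = 0 by rewrite /G /Fl /log2 ln1 mul0r mulr0.
have sz_y : n = (size y).+2 by rewrite size_tuple; lia.
(* The terms omitted from [Wsum] equal [G 0 = 0]. *)
have WE : Wsum R y = excess2 G y.
  rewrite /excess2 -sz_y -bsumE /Wsum big_mkcond /=.
  by apply: eq_bigr => x _; rewrite omegaE; case: eqP => //= ->.
rewrite WE -[tval y in LHS]of_runsK excess2_of_runs ?runs_gt0 // -/r.
congr (_ + _ + _ + _).
- by rewrite (big_nth 0%N) big_mkord; apply: eq_bigr => i _; rewrite addn2.
- by rewrite -pair_sumE.
- rewrite (big_nth 0%N) big_mkord; apply: eq_bigr => i _; rewrite addn1.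
  rewrite -(size_of_runs (head true y)) of_runsK -/RR [in RHS]sz_y.
  by rewrite -[(size y).+2%:R]natr1 -[(size y).+1%:R]natr1; congr (_ * _); ring.
rewrite {}/A {}/a -seg_sum_alts // -[in LHS](drop0 (alts y)).
(* The default b_1 = 1 makes the initial distance 0. *)
rewrite -[0%N in LHS]/(1 - bidx (alts y) 1)%N.
rewrite -(sum_segments _ G (ltn0Sn 0)); apply: eq_big_nat => i i_in.
by rewrite /G -segment_term // alts_gt0.
Qed.
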